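(* Consider the closed-loop system with additive disturbance $\omega(k)\in\mathbb{R}^p$ and feedback gain $K\in\mathbb{R}^{m\times n}$ $$x(k+1)=A_0x(k)+A_1x(k-h_1(k))+BKx(k-h_2(k))+D_0\omega(k),\qquad(\ast)$$ with $x(k)\in\mathbb{R}^n$ and unknown constant real matrices $A_0,A_1\in\mathbb{R}^{n\times n}$, $B\in\mathbb{R}^{n\times m}$, together with the performance output $$z(k)=L_1x(k)+L_2x(k-h_1(k))+DKx(k-h_2(k))\in\mathbb{R}^q,$$ with constant matrices $L_1,L_2\in\mathbb{R}^{q\times n}$, $D_0\in\mathbb{R}^{n\times p}$, $D\in\mathbb{R}^{q\times m}$. Let the data matrices $U_{h_2,\{0\}},X_{h_1,\{0\}},X_{\{0\}},X_{\{1\}},W_0$ be as defined in the context and suppose that $\mathrm{rank}(W_0)=m+2n$. Given positive constants $\bar h$ (an integer) and $\gamma$ and the tuning parameter $\varepsilon>0$, suppose that there exist $n\times n$ matrices $\bar P>0$, $\bar S>0$, $\bar R_i>0$ and $\bar S_{12,i}>0$, $i\in\{1,2\}$, and $T\times n$ matrices $Q_1,Q_2,Q_3$ such that $$\bar{\mathbf{\Gamma}}=\begin{bmatrix}\bar{\mathbf{\Psi}} & \kappa_2^\top\\ \star & \gamma I_p\end{bmatrix}>0,\qquad \kappa_2=\begin{bmatrix}-D_0^\top & 0 & 0 & 0 & -\varepsilon D_0^\top & 0\end{bmatrix},$$ $$\begin{bmatrix}\bar R_i & \bar S_{12,i}\\ \star & \bar R_i\end{bmatrix}\ge0,\quad i\in\{1,2\},$$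 with the matrix $\bar{\mathbf{\Psi}}$ given in the context, and $$\begin{aligned}U_{h_2,\{0\}}Q_2&=U_{h_2,\{0\}}Q_3=0,\\ X_{h_1,\{0\}}Q_1&=X_{h_1,\{0\}}Q_3=0,\\ X_{\{0\}}Q_1&=X_{\{0\}}Q_2=0,\\ X_{h_1,\{0\}}Q_2&=X_{\{0\}}Q_3.\end{aligned}$$ Choose the feedback gain $K=U_{h_2,\{0\}}Q_1\big(X_{\{0\}}Q_3\big)^{-1}$. Then for all delays $h_1(k)\in[0,\bar h]$ and $h_2(k)\in[0,\bar h]$, the origin of $(\ast)$ is an asymptotically stable equilibrium point for $\omega(k)=0$. Furthermore, for $\omega(k)\ne0$ the system $(\ast)$ has an $L_2$-gain less than $\gamma$.
   Context: The delays $h_1(k),h_2(k)$ are integer-valued, possibly time-varying and uncertain. The $L_2$-gain is the maximum energy amplification ratio from $\omega$ to $z$, i.e. the supremum of $\sum_{k\ge0}z^\top(k)z(k)\big/\sum_{k\ge0}\omega^\top(k)\omega(k)$ over nonzero square-summable $\omega$ with zero initial history; in the paper, $L_2$-gain less than $\gamma$ is certified through $\sum_{k=0}^\infty\big(z^\top(k)z(k)-\gamma\,\omega^\top(k)\omega(k)\big)<0$. Recorded data: sequences $u(k)\in\mathbb{R}^m$, $x(k)\in\mathbb{R}^n$, $k=-\bar h,\dots,T$, with $T>\bar h$, are available, satisfying $x(k+1)=A_0x(k)+A_1x(k-h_1)+Bu(k-h_2)$ for $k=0,\dots,T-1$ with constant known delays $h_1,h_2\in\{0,\dots,\bar h\}$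 (the delays are constant while the data are recorded, though they may vary in closed-loop operation). Set $U_{h_2,\{0\}}=[u(-h_2)\ \cdots\ u(T-1-h_2)]$, $X_{h_1,\{0\}}=[x(-h_1)\ \cdots\ x(T-1-h_1)]$, $X_{\{0\}}=[x(0)\ \cdots\ x(T-1)]$, $X_{\{1\}}=[x(1)\ \cdots\ x(T)]$, and $W_0=\begin{bmatrix}U_{h_2,\{0\}}\\ X_{h_1,\{0\}}\\ X_{\{0\}}\end{bmatrix}\in\mathbb{R}^{(m+2n)\times T}$. $M>0$ means $M$ is symmetric positive definite; $\star$ denotes entries below the diagonal determined by symmetry. Define $$\bar{\mathbf{\Psi}}=\begin{bmatrix}\bar{\mathbf{\Phi}} & -\kappa^\top\\ \star & I_q\end{bmatrix},\qquad \kappa=\begin{bmatrix}L_1X_{\{0\}}Q_3 & L_2X_{\{0\}}Q_3 & DU_{h_2,\{0\}}Q_1 & 0 & 0\end{bmatrix},$$ where the symmetric $5n\times5n$ matrix $\bar{\mathbf{\Phi}}$ is $$\bar{\mathbf{\Phi}}=\begin{bmatrix} \bar{\mathbf{\Phi}}_{11} & \bar{\mathbf{\Phi}}_{12} & \bar{\mathbf{\Phi}}_{13} & -\bar S_{12,1}-\bar S_{12,2} & \bar{\mathbf{\Phi}}_{15}\\ \star & 2\bar R_1-\bar S_{12,1}-\bar S_{12,1}^\top & 0 & -\bar R_1+\bar S_{12,1} & -\varepsilon(X_{\{1\}}Q_2)^\top\\ \star & \star & 2\bar R_2-\bar S_{12,2}-\bar S_{12,2}^\top & -\bar R_2+\bar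 S_{12,2} & -\varepsilon(X_{\{1\}}Q_1)^\top\\ \star & \star & \star & \bar R_1+\bar R_2+\bar S & 0\\ \star & \star & \star & \star & \bar{\mathbf{\Phi}}_{55}\end{bmatrix},$$ with $\bar{\mathbf{\Phi}}_{11}=\bar P-\bar S+(1-\bar h^2)(\bar R_1+\bar R_2)-X_{\{1\}}Q_3-(X_{\{1\}}Q_3)^\top$, $\bar{\mathbf{\Phi}}_{12}=-\bar R_1+\bar S_{12,1}-X_{\{1\}}Q_2$, $\bar{\mathbf{\Phi}}_{13}=-\bar R_2+\bar S_{12,2}-X_{\{1\}}Q_1$, $\bar{\mathbf{\Phi}}_{15}=\bar h^2(\bar R_1+\bar R_2)+X_{\{0\}}Q_3-\varepsilon(X_{\{1\}}Q_3)^\top$, $\bar{\mathbf{\Phi}}_{55}=-\bar P-\bar h^2(\bar R_1+\bar R_2)+\varepsilon(X_{\{0\}}Q_3+Q_3^\top X_{\{0\}}^\top)$. In $\kappa_2$ the first five blocks have $n$ columns each and the last zero block has $q$ columns. (The condition $\bar{\mathbf{\Phi}}>0$ implies that $X_{\{0\}}Q_3$ is nonsingular, so $K$ is well defined.) *)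

(* Defs.v *)
From HB Require Import structures.
From mathcomp Require Import all_boot all_order all_algebra.
From mathcomp Require Import all_classical all_reals all_analysis.

Set Implicit Arguments.
Unset Strict Implicit.
Unset Printing Implicit Defensive.

Import Order.TTheory GRing.Theory Num.Theory.
Import numFieldNormedType.Exports.

Local Open Scope classical_set_scope.
Local Open Scope ring_scope.

Section Matrices.
Variable R : realType.

Definition posdef n (M : 'M[R]_n) : Prop :=
  M^T = M /\ forall v : 'cV[R]_n, v != 0 -> 0 < (v^T *m M *m v) 0 0.

Definition possemidef n (M : 'M[R]_n) : Prop :=
  M^T = M /\ forall v : 'cV[R]_n, 0 <= (v^T *m M *m v) 0 0.

(* [[M, N], [*, O]], the star being the block determined by symmetry *)
Definition symblock_mx n m (M : 'M[R]_n) (N : 'M[R]_(n, m)) (O : 'M[R]_m) :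
    'M[R]_(n + m) :=
  block_mx M N N^T O.

Definition row_mx3 l a b c
    (M1 : 'M[R]_(l, a)) (M2 : 'M[R]_(l, b)) (M3 : 'M[R]_(l, c)) :
    'M[R]_(l, a + (b + c)) :=
  row_mx M1 (row_mx M2 M3).

Definition row_mx4 l a b c d
    (M1 : 'M[R]_(l, a)) (M2 : 'M[R]_(l, b)) (M3 : 'M[R]_(l, c))
    (M4 : 'M[R]_(l, d)) : 'M[R]_(l, a + (b + (c + d))) :=
  row_mx M1 (row_mx3 M2 M3 M4).

Definition row_mx5 l a b c d e
    (M1 : 'M[R]_(l, a)) (M2 : 'M[R]_(l, b)) (M3 : 'M[R]_(l, c))
    (M4 : 'M[R]_(l, d)) (M5 : 'M[R]_(l, e)) :
    'M[R]_(l, a + (b + (c + (d + e)))) :=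
  row_mx M1 (row_mx4 M2 M3 M4 M5).

(* [v(s) v(s+1) ... v(s+T-1)] *)
Definition data_mx n T (v : int -> 'cV[R]_n) (s : int) : 'M[R]_(n, T) :=
  \matrix_(i < n, j < T) v (s + (j : nat)%:Z) i 0.

End Matrices.

Section LMI.
Variables (R : realType) (n m p q T : nat) (hbar : nat) (eps gamma : R).
Variables (D0 : 'M[R]_(n, p)) (L1 L2 : 'M[R]_(q, n)) (D : 'M[R]_(q, m)).
(* U, X0, X1 are the data matrices U_{h_2,{0}}, X_{{0}}, X_{{1}} *)
Variables (U : 'M[R]_(m, T)) (X0 X1 : 'M[R]_(n, T)).
Variables (P S R1 R2 S1 S2 : 'M[R]_n) (Q1 Q2 Q3 : 'M[R]_(T, n)).

Let hbar2 : R := hbar%:R ^+ 2.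

Definition Phi11 : 'M[R]_n :=
  P - S + (1 - hbar2) *: (R1 + R2) - X1 *m Q3 - (X1 *m Q3)^T.
Definition Phi12 : 'M[R]_n := - R1 + S1 - X1 *m Q2.
Definition Phi13 : 'M[R]_n := - R2 + S2 - X1 *m Q1.
Definition Phi14 : 'M[R]_n := - S1 - S2.
Definition Phi15 : 'M[R]_n :=
  hbar2 *: (R1 + R2) + X0 *m Q3 - eps *: (X1 *m Q3)^T.
Definition Phi22 : 'M[R]_n := 2%:R *: R1 - S1 - S1^T.
Definition Phi24 : 'M[R]_n := - R1 + S1.
Definition Phi25 : 'M[R]_n := - (eps *: (X1 *m Q2)^T).
Definition Phi33 : 'M[R]_n := 2%:R *: R2 - S2 - S2^T.
Definition Phi34 : 'M[R]_n := - R2 + S2.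
Definition Phi35 : 'M[R]_n := - (eps *: (X1 *m Q1)^T).
Definition Phi44 : 'M[R]_n := R1 + R2 + S.
Definition Phi55 : 'M[R]_n :=
  - P - hbar2 *: (R1 + R2) + eps *: (X0 *m Q3 + Q3^T *m X0^T).

Definition Phi_bar : 'M[R]_(n + (n + (n + (n + n)))) :=
  symblock_mx Phi11 (row_mx4 Phi12 Phi13 Phi14 Phi15)
    (symblock_mx Phi22 (row_mx3 (0 : 'M[R]_n) Phi24 Phi25)
      (symblock_mx Phi33 (row_mx Phi34 Phi35)
        (symblock_mx Phi44 0 Phi55))).

Definition kappa : 'M[R]_(q, n + (n + (n + (n + n)))) :=
  row_mx5 (L1 *m X0 *m Q3) (L2 *m X0 *m Q3) (D *m U *m Q1)
    (0 : 'M[R]_(q, n)) (0 : 'M[R]_(q, n)).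

Definition Psi_bar : 'M[R]_(n + (n + (n + (n + n))) + q) :=
  symblock_mx Phi_bar (- kappa^T) 1%:M.

Definition kappa2 : 'M[R]_(p, n + (n + (n + (n + n))) + q) :=
  row_mx
    (row_mx5 (- D0^T) (0 : 'M[R]_(p, n)) (0 : 'M[R]_(p, n))
       (0 : 'M[R]_(p, n)) (- (eps *: D0^T)))
    (0 : 'M[R]_(p, q)).

Definition Gamma_bar : 'M[R]_(n + (n + (n + (n + n))) + q + p) :=
  symblock_mx Psi_bar kappa2^T gamma%:M.

End LMI.

Section DelaySystems.
Variables (R : realType) (n m p q : nat).
Variables (A0 A1 : 'M[R]_n) (B : 'M[R]_(n, m)) (K : 'M[R]_(m, n)).
Variables (D0 : 'M[R]_(n, p)) (L1 L2 : 'M[R]_(q, n)) (D : 'M[R]_(q, m)).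
Variables (h1 h2 : nat -> nat).

(* x is indexed by int because the dynamics reads the history of x before the
   initial time k0; no constraint is put on x at times up to k0. *)
Definition closed_loop (w : nat -> 'cV[R]_p) (k0 : nat)
    (x : int -> 'cV[R]_n) : Prop :=
  forall k : nat, (k0 <= k)%N ->
    x (k%:Z + 1) = A0 *m x k%:Z + A1 *m x (k%:Z - (h1 k)%:Z)
                   + B *m K *m x (k%:Z - (h2 k)%:Z) + D0 *m w k.

Definition output (x : int -> 'cV[R]_n) (k : nat) : 'cV[R]_q :=
  L1 *m x k%:Z + L2 *m x (k%:Z - (h1 k)%:Z)
  + D *m K *m x (k%:Z - (h2 k)%:Z).

End DelaySystems.

Section Stability.
Variables (R : realType) (n hbar : nat).
(* [traj k0 x]: x is a trajectory started at time k0 *)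
Variable traj : nat -> (int -> 'cV[R]_n) -> Prop.

Definition history_lt (k0 : nat) (x : int -> 'cV[R]_n) (delta : R) : Prop :=
  forall j : nat, (j <= hbar)%N -> `|x (k0%:Z - j%:Z)| < delta.

Definition origin_equilibrium : Prop := forall k0 : nat, traj k0 (fun=> 0).

(* The systems are time-varying, so delta may depend on the initial time. *)
Definition origin_stable : Prop :=
  forall (k0 : nat) (e : R), 0 < e ->
  exists2 delta : R, 0 < delta &
  forall x, traj k0 x -> history_lt k0 x delta ->
  forall k : nat, (k0 <= k)%N -> `|x k%:Z| < e.

Definition origin_attractive : Prop :=
  forall k0 : nat, exists2 delta : R, 0 < delta &
  forall x, traj k0 x -> history_lt k0 x delta ->
  x k%:Z @[k --> \oo] --> (0 : 'cV[R]_n).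

Definition origin_asymptotically_stable : Prop :=
  [/\ origin_equilibrium, origin_stable & origin_attractive].

End Stability.

Section L2Gain.
Variable R : realType.

Definition energy n (v : nat -> 'cV[R]_n) : \bar R :=
  (\sum_(0 <= k <oo) (((v k)^T *m v k) 0 0)%:E)%E.

(* The gain is the supremum of the ratio of energies, without square root.
   [traj w x]: x is a trajectory started at time 0 under the disturbance w;
   [out x]: the output along x. *)
Definition L2_gain n p q hbar (traj : (nat -> 'cV[R]_p) -> (int -> 'cV[R]_n) -> Prop)
    (out : (int -> 'cV[R]_n) -> nat -> 'cV[R]_q) : \bar R :=
  ereal_sup [set g : \bar R | exists w : nat -> 'cV[R]_p,
    exists x : int -> 'cV[R]_n,
    [/\ (energy w < +oo)%E, exists k, w k != 0,
        forall j : nat, (j <= hbar)%N -> x (- j%:Z) = 0,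
        traj w x
      & g = (energy (out x) / energy w)%E]].

End L2Gain.

(* Main.v *)
(* Put G = X0 Q3 and v(k) = G^-1 x(k). The data equations give X1 Q3 = A0 G,
   X1 Q2 = A1 G and X1 Q1 = B K G, so the matrix inequality is a condition on the
   closed loop in the coordinates v. With eta(j) = v(j+1) - v(j), take the
   functional
     V(k) = v(k)' P v(k) + sum_(k-h <= j < k) v(j)' S v(j)
          + h sum_(-h <= i < 0) sum_(k+i <= j < k) eta(j)' (R1 + R2) eta(j).
   Jensen's inequality bounds the delayed part of its increment, and adding the
   null terms 2 (v(k) + eps v(k+1))' (x(k+1) - A0 x(k) - ...) yields
     V(k+1) - V(k) + |z(k)|^2 - gamma |w(k)|^2 <= - (form of Gamma_bar)
   at the vector (v(k), v(k-h1), v(k-h2), v(k-h), v(k+1), z(k), w(k)). The form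
   is at least c times the squared norm for some c > 0: for w = 0 this is the
   Lyapunov decrease, and the part - c |w(k)|^2, summed over time, makes the gain
   strictly smaller than gamma. *)
Require Import Defs.
From mathcomp Require Import all_boot all_order all_algebra.
From mathcomp Require Import all_classical all_reals all_analysis.
From mathcomp Require Import ring lra.

Set Implicit Arguments.
Unset Strict Implicit.
Unset Printing Implicit Defensive.

Import Order.TTheory GRing.Theory Num.Theory.
Import numFieldNormedType.Exports.

Local Open Scope ring_scope.

(** * Bilinear and quadratic forms of matrices, coercivity and sup-norm bounds *)

Section Forms.
Variable R : realType.

Definition bform a b (M : 'M[R]_(a, b)) (u : 'cV[R]_a) (v : 'cV[R]_b) : R :=
  (u^T *m M *m v) 0 0.

Definition qform a (M : 'M[R]_a) (v : 'cV[R]_a) : R := bform M v v.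

Lemma bformDm a b (M N : 'M[R]_(a, b)) u v :
  bform (M + N) u v = bform M u v + bform N u v.
Proof. by rewrite /bform mulmxDr mulmxDl mxE. Qed.

Lemma bformNm a b (M : 'M[R]_(a, b)) u v : bform (- M) u v = - bform M u v.
Proof. by rewrite /bform mulmxN mulNmx mxE. Qed.

Lemma bformZm a b c (M : 'M[R]_(a, b)) u v :
  bform (c *: M) u v = c * bform M u v.
Proof. by rewrite /bform -scalemxAr -scalemxAl mxE. Qed.

Lemma bform0m a b u v : bform (0 : 'M[R]_(a, b)) u v = 0.
Proof. by rewrite /bform mulmx0 mul0mx mxE. Qed.

Lemma bform_tr a b (M : 'M[R]_(a, b)) u v : bform M^T u v = bform M v u.
Proof.
have E : u^T *m M^T *m v = (v^T *m M *m u)^T by rewrite !trmx_mul trmxK mulmxA.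
by rewrite /bform E mxE.
Qed.

Lemma bformDl a b (M : 'M[R]_(a, b)) u u' v :
  bform M (u + u') v = bform M u v + bform M u' v.
Proof. by rewrite /bform raddfD !mulmxDl mxE. Qed.

Lemma bformDr a b (M : 'M[R]_(a, b)) u v v' :
  bform M u (v + v') = bform M u v + bform M u v'.
Proof. by rewrite /bform !mulmxDr mxE. Qed.

Lemma bformNl a b (M : 'M[R]_(a, b)) u v : bform M (- u) v = - bform M u v.
Proof. by rewrite /bform raddfN !mulNmx mxE. Qed.

Lemma bformNr a b (M : 'M[R]_(a, b)) u v : bform M u (- v) = - bform M u v.
Proof. by rewrite /bform !mulmxN mxE. Qed.

Lemma bformZl a b c (M : 'M[R]_(a, b)) u v : bform M (c *: u) v = c * bform M u v.
Proof. by rewrite /bform linearZ /= -!scalemxAl mxE. Qed.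

Lemma bformZr a b c (M : 'M[R]_(a, b)) u v : bform M u (c *: v) = c * bform M u v.
Proof. by rewrite /bform -!scalemxAr mxE. Qed.

Lemma bform0l a b (M : 'M[R]_(a, b)) v : bform M 0 v = 0.
Proof. by rewrite /bform trmx0 !mul0mx mxE. Qed.

Lemma bform0r a b (M : 'M[R]_(a, b)) u : bform M u 0 = 0.
Proof. by rewrite /bform !mulmx0 mxE. Qed.

Lemma bform_mulmx a b c (M : 'M[R]_(a, b)) (N : 'M[R]_(b, c)) u v :
  bform (M *m N) u v = bform M u (N *m v).
Proof. by rewrite /bform !mulmxA. Qed.

Lemma bform_suml a b (M : 'M[R]_(a, b)) k (E : nat -> 'cV[R]_a) v :
  bform M (\sum_(i < k) E i) v = \sum_(i < k) bform M (E i) v.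
Proof. by elim/big_rec2: _ => [|i y u _ <-]; rewrite ?bform0l ?bformDl. Qed.

Lemma bform_row_mx l a b (M : 'M[R]_(l, a)) (N : 'M[R]_(l, b)) u v w :
  bform (row_mx M N) u (col_mx v w) = bform M u v + bform N u w.
Proof. by rewrite /bform -mulmxA mul_row_col mulmxDr !mulmxA mxE. Qed.

Lemma qform_symblock a b (M : 'M[R]_a) (N : 'M[R]_(a, b)) (O : 'M[R]_b) u v :
  qform (symblock_mx M N O) (col_mx u v) =
  qform M u + 2 * bform N u v + qform O v.
Proof.
rewrite /qform {1}/bform /symblock_mx -mulmxA mul_block_col tr_col_mx mul_row_col.
rewrite !mulmxDr !mulmxA [LHS]mxE [X in X + _ = _]mxE [X in _ + X = _]mxE.
by rewrite -!/(bform _ _ _) bform_tr; ring.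
Qed.

Lemma psd_qform_ge0 a (M : 'M[R]_a) v : possemidef M -> 0 <= qform M v.
Proof. by case=> _; exact. Qed.

Lemma posdef_psd a (M : 'M[R]_a) : posdef M -> possemidef M.
Proof.
case=> sM pM; split=> // v; have [->|/pM/ltW //] := eqVneq v 0.
by rewrite -/(bform M 0 0) bform0r.
Qed.

Lemma bform_sym a (M : 'M[R]_a) u v : M^T = M -> bform M u v = bform M v u.
Proof. by move=> sM; rewrite -bform_tr sM. Qed.

Lemma qformDZ a (M : 'M[R]_a) c u v : M^T = M ->
  qform M (u + c *: v) = qform M u + 2 * c * bform M u v + c ^+ 2 * qform M v.
Proof.
move=> sM; rewrite /qform !(bformDl, bformDr, bformZl, bformZr).
by rewrite (bform_sym v u sM); ring.
Qed.

(** Discrete Jensen inequality. By induction on [k]: nonnegativity of the form at [E i - E k] bounds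
    each new cross term by the two diagonal ones. *)
Lemma qform_sum_le a (M : 'M[R]_a) k (E : nat -> 'cV[R]_a) : possemidef M ->
  qform M (\sum_(i < k) E i) <= k%:R * \sum_(i < k) qform M (E i).
Proof.
move=> psM; elim: k => [|k IH]; first by rewrite !big_ord0 /qform bform0l mul0r.
have -> : \sum_(i < k.+1) E i = \sum_(i < k) E i + 1 *: E k.
  by rewrite big_ord_recr /= scale1r.
rewrite qformDZ ?(proj1 psM) // big_ord_recr /= -natr1.
suff : 2 * bform M (\sum_(i < k) E i) (E k) <=
       (\sum_(i < k) qform M (E i)) + k%:R * qform M (E k) by lra.
have -> : k%:R * qform M (E k) = \sum_(i < k) qform M (E k).
  by rewrite sumr_const card_ord mulr_natl.
rewrite -big_split /= bform_suml mulr_sumr; apply: ler_sum => i _.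
have := psd_qform_ge0 (E i + (-1) *: E k) psM.
by rewrite qformDZ ?(proj1 psM) //; lra.
Qed.

(** A row vector killed by [M] makes the form vanish at its transpose. Symmetry is not assumed, so
    this also applies to [X0 *m Q3]. *)
Lemma anisotropic_unitmx a (M : 'M[R]_a) :
  (forall v, v != 0 -> qform M v != 0) -> M \in unitmx.
Proof.
move=> nzM; rewrite -row_free_unit -kermx_eq0; apply/eqP.
apply/eqP; rewrite -submx0; apply/rV_subP => v /sub_kermxP vM0.
have [->|vn0] := eqVneq v 0; first exact: sub0mx.
have : v^T != 0 by rewrite -(trmx0 R) (inj_eq trmx_inj).
by move/nzM; rewrite /qform /bform trmxK vM0 mul0mx mxE eqxx.
Qed.

(** The form is nonnegative at [u] minus its [M]-orthogonal projection onto [v]. *)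
Lemma cauchy_schwarz_form a (M : 'M[R]_a) u v : posdef M ->
  bform M u v ^+ 2 <= qform M u * qform M v.
Proof.
move=> pM; have [->|/(proj2 pM) vpos] := eqVneq v 0.
  by rewrite /qform !bform0r expr0n mulr0.
rewrite -/(qform M v) in vpos.
have := psd_qform_ge0 (u + (- (bform M u v / qform M v)) *: v) (posdef_psd pM).
rewrite qformDZ ?(proj1 pM) // => H.
have -> : qform M u * qform M v = bform M u v ^+ 2 +
  (qform M u + 2 * - (bform M u v / qform M v) * bform M u v +
   (- (bform M u v / qform M v)) ^+ 2 * qform M v) * qform M v.
  by field; rewrite gt_eqF.
by rewrite lerDl mulr_ge0 // ltW.
Qed.

Lemma normsq_sum a (v : 'cV[R]_a) : (v^T *m v) 0 0 = \sum_i v i 0 ^+ 2.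
Proof. by rewrite mxE; apply: eq_bigr => i _; rewrite mxE expr2. Qed.

Lemma normsq_ge0 a (v : 'cV[R]_a) : 0 <= (v^T *m v) 0 0.
Proof. by rewrite normsq_sum sumr_ge0 // => i _; rewrite sqr_ge0. Qed.

Lemma normsq_col_mx a b (u : 'cV[R]_a) (v : 'cV[R]_b) :
  ((col_mx u v)^T *m col_mx u v) 0 0 = (u^T *m u) 0 0 + (v^T *m v) 0 0.
Proof. by rewrite tr_col_mx mul_row_col mxE. Qed.

(* Cauchy-Schwarz for the form of M, applied to v and to the columns of M^-1,
   bounds each coordinate of v. *)
Lemma posdef_coercive a (M : 'M[R]_a) : posdef M ->
  exists2 c : R, 0 < c & forall v, c * (v^T *m v) 0 0 <= qform M v.
Proof.
move=> pM; have uM : M \in unitmx.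
  by apply: anisotropic_unitmx => v /(proj2 pM); rewrite -/(qform M v) => /gt_eqF ->.
pose f i : 'cV[R]_a := invmx M *m delta_mx i 0.
pose s := \sum_i qform M (f i).
have s0 : 0 <= s.
  by apply: sumr_ge0 => i _; apply: psd_qform_ge0; apply: posdef_psd.
(* Summing the coordinate bounds gives the factor [s]; [1 + s] is used because [s] vanishes in
   dimension zero. *)
have s1 : 0 < 1 + s by rewrite ltr_pwDl.
exists (1 + s)^-1; rewrite ?invr_gt0 // => v.
rewrite ler_pdivrMl // normsq_sum.
have vM : 0 <= qform M v by apply: psd_qform_ge0; apply: posdef_psd.
apply: (@le_trans _ _ (s * qform M v)); last by rewrite ler_wpM2r // lerDr.
rewrite mulr_suml; apply: ler_sum => i _.
have -> : v i 0 = bform M (f i) v.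
  rewrite (bform_sym _ _ (proj1 pM)) /bform /f -mulmxA (mulmxA M) mulmxV // mul1mx.
  rewrite mxE (bigD1 i) //= big1 ?addr0 => [|j ji]; rewrite !mxE ?eqxx ?mulr1 //.
  by rewrite (negbTE ji) mulr0.
exact: cauchy_schwarz_form.
Qed.

Lemma entry_norm_le a b (A : 'M[R]_(a, b)) i j : `|A i j| <= `|A|.
Proof.
rewrite [X in _ <= X]mx_normrE.
exact: (@le_bigmax _ _ _ 0 (fun ij : 'I_a * 'I_b => `|A ij.1 ij.2|) (i, j)).
Qed.

(** The norm is the sup norm: it is attained at some entry, whose square is one summand of
    [v^T *m v]. *)
Lemma norm_sq_le a (v : 'cV[R]_a) : `|v| ^+ 2 <= (v^T *m v) 0 0.
Proof.
have [->|vn0] := eqVneq v 0; first by rewrite normr0 mulmx0 mxE expr0n.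
have [|ij vE] := @mx_norm_neq0 R _ _ v.
  by apply: contra_neq vn0; exact: mx_norm_eq0.
rewrite [`|v|]vE -normrX ger0_norm ?sqr_ge0 // normsq_sum (bigD1 ij.1) //= (ord1 ij.2).
by rewrite lerDl sumr_ge0 // => k _; rewrite sqr_ge0.
Qed.

Lemma mulmx_norm_le a b (A : 'M[R]_(a, b)) :
  exists2 C : R, 0 < C & forall v : 'cV[R]_b, `|A *m v| <= C * `|v|.
Proof.
(* A row-by-column product has [b] summands; the extra 1 keeps the constant positive when [A] is
   zero or empty. *)
exists (1 + b%:R * `|A|); first by rewrite ltr_pwDl // mulr_ge0.
move=> v; rewrite [X in X <= _]mx_normrE.
apply: bigmax_le => [|ij _]; first by rewrite mulr_ge0 // addr_ge0 // mulr_ge0.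
rewrite mxE (le_trans (ler_norm_sum _ _ _)) // mulrDl mul1r.
apply: ler_wpDl => //; rewrite -mulrA mulr_natl -[X in _ *+ X]card_ord.
rewrite -sumr_const ler_sum // => k _; rewrite normrM.
by rewrite ler_pM // entry_norm_le.
Qed.

Lemma qform_norm_le a (M : 'M[R]_a) :
  exists2 C : R, 0 < C & forall v, qform M v <= C * `|v| ^+ 2.
Proof.
have [C C0 MC] := mulmx_norm_le M; exists (1 + a%:R * C).
  by rewrite ltr_pwDl // mulr_ge0 // ltW.
move=> v; rewrite mulrDl mul1r ler_wpDl ?sqr_ge0 //.
rewrite /qform /bform -mulmxA mxE -mulrA mulr_natl -[X in _ *+ X]card_ord.
rewrite -sumr_const ler_sum // => k _; rewrite mxE.
apply: (le_trans (ler_norm _)); rewrite normrM mulrC expr2 mulrA.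
by rewrite ler_pM ?entry_norm_le // (le_trans (entry_norm_le _ _ _)).
Qed.

End Forms.

(** * The Lyapunov-Krasovskii functional: increment, bounds, and Jensen's inequality with a delay *)

Section LyapunovKrasovskii.
Variables (R : realType) (n h : nat).

(* The sequence y lists the states backwards in time, the current one first. *)
Definition lkf (P S V : 'M[R]_n) (y : nat -> 'cV[R]_n) : R :=
  qform P (y 0%N) + \sum_(j < h) qform S (y j.+1)
  + h%:R * \sum_(i < h) \sum_(j < i.+1) qform V (y j - y j.+1).

(** Dropping the newest state steps back in time, and the sums telescope: the [S] sum leaves its two
    ends, and each of the [h] inner sums leaves the newest increment minus one delayed increment. *)
Lemma lkf_shift (P S V : 'M[R]_n) (y : nat -> 'cV[R]_n) :
  lkf P S V y - lkf P S V (fun j => y j.+1) =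
  qform P (y 0%N) - qform P (y 1%N) + qform S (y 1%N) - qform S (y h.+1)
  + h%:R * (h%:R * qform V (y 0%N - y 1%N)
            - \sum_(i < h) qform V (y i.+1 - y i.+2)).
Proof.
have tele (f : nat -> R) k :
    \sum_(j < k) f j - \sum_(j < k) f j.+1 = f 0%N - f k.
  elim: k => [|k IH]; first by rewrite !big_ord0; ring.
  by rewrite !big_ord_recr /=; move: IH; lra.
pose r j := qform V (y j - y j.+1).
have E1 := tele (fun j => qform S (y j.+1)) h.
have E2 : \sum_(i < h) \sum_(j < i.+1) r j
    - \sum_(i < h) \sum_(j < i.+1) r j.+1
    = h%:R * r 0%N - \sum_(i < h) r i.+1.
  rewrite -sumrB; under eq_bigr => i _ do rewrite (tele r).
  by rewrite sumrB sumr_const card_ord mulr_natl.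
rewrite /lkf /= -/(r _) -E2; move: E1 => /= E1; lra.
Qed.

Lemma lkf_ge (P S V : 'M[R]_n) (y : nat -> 'cV[R]_n) :
  possemidef S -> possemidef V -> qform P (y 0%N) <= lkf P S V y.
Proof.
move=> pS pV; rewrite /lkf -addrA lerDl addr_ge0 //.
  by apply: sumr_ge0 => j _; apply: psd_qform_ge0.
rewrite mulr_ge0 //; apply: sumr_ge0 => i _; apply: sumr_ge0 => j _.
exact: psd_qform_ge0.
Qed.

Lemma lkf_norm_le (P S V : 'M[R]_n) : exists2 C : R, 0 < C &
  forall y e, (forall j, (j <= h)%N -> `|y j| <= e) ->
  lkf P S V y <= C * e ^+ 2.
Proof.
have [CP CP0 PC] := qform_norm_le P; have [CS CS0 SC] := qform_norm_le S.
have [CV CV0 VC] := qform_norm_le V.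
exists (CP + h%:R * CS + h%:R * \sum_(i < h) \sum_(j < i.+1) (4 * CV)).
  rewrite -addrA ltr_pwDl // addr_ge0 ?mulr_ge0 ?(ltW CS0) //.
  by do 2![apply: sumr_ge0 => ? _]; rewrite mulr_ge0 // ltW.
move=> y e ye; have e0 : 0 <= e by rewrite (le_trans _ (ye 0%N _)).
rewrite /lkf 2!mulrDl; apply: lerD; first apply: lerD.
- by rewrite (le_trans (PC _)) // ler_wpM2l ?(ltW CP0) // ler_pXn2r ?nnegrE // ye.
- rewrite -mulrA mulr_natl -[X in _ *+ X]card_ord -sumr_const ler_sum // => j _.
  by rewrite (le_trans (SC _)) // ler_wpM2l ?(ltW CS0) // ler_pXn2r ?nnegrE // ye.
- rewrite -mulrA ler_wpM2l // mulr_suml ler_sum // => i _.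
  rewrite mulr_suml ler_sum // => j _.
  (* An increment is a difference of two states of norm at most [e], so its squared norm is at most
     [4 * e ^+ 2]. *)
  rewrite (le_trans (VC _)) // (_ : 4 * CV * e ^+ 2 = CV * (e + e) ^+ 2); last by ring.
  rewrite ler_wpM2l ?(ltW CV0) // ler_pXn2r ?nnegrE ?addr_ge0 //.
  have jh : (j < h)%N by rewrite (leq_trans (ltn_ord j)).
  by rewrite (le_trans (ler_normB _ _)) // lerD // ye // ltnW.
Qed.

(* Reciprocally convex combination: Jensen's inequality for the form of the
   block matrix, over the increments placed in the first component before the
   delay d and in the second one after it. *)
Lemma delayed_jensen (V N : 'M[R]_n) (y : nat -> 'cV[R]_n) d :
  possemidef (symblock_mx V N V) -> (d <= h)%N ->
  qform V (y 0%N - y d) + 2 * bform N (y 0%N - y d) (y d - y h)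
  + qform V (y d - y h) <= h%:R * \sum_(i < h) qform V (y i - y i.+1).
Proof.
move=> psB dh; pose D j := y j - y j.+1.
pose E j := if (j < d)%N then col_mx (D j) 0 else col_mx 0 (D j).
have sumE k : (k <= h)%N -> \sum_(i < k) E i =
    if (k <= d)%N then col_mx (y 0%N - y k) 0
    else col_mx (y 0%N - y d) (y d - y k).
  elim: k => [|k IH] kh; first by rewrite big_ord0 leq0n subrr col_mx0.
  rewrite big_ord_recr /= (IH (ltnW kh)) /E /D; case: (ltngtP k d) => [kd|kd|->].
  - by rewrite add_col_mx addr0 addrA subrK.
  - by rewrite add_col_mx addr0 addrA subrK.
  - by rewrite add_col_mx addr0 add0r.
(* Each [E i] has a zero component, so [N] contributes nothing to a single term; it appears only in
   the form of the sum. *)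
have qE i : qform (symblock_mx V N V) (E i) = qform V (D i).
  rewrite /E; case: ifP => _; rewrite qform_symblock ?bform0r ?bform0l /qform;
    by rewrite ?bform0l; ring.
have := qform_sum_le h E psB; under [X in _ <= _ * X]eq_bigr do rewrite qE.
rewrite sumE //; case: (ltngtP h d) dh => // [dlt|<-] _;
  rewrite qform_symblock ?subrr //.
Qed.

End LyapunovKrasovskii.

(** * The dissipation inequality, and invertibility of the change of coordinates *)

Section Dissipation.
Variables (R : realType) (n m p q T h : nat) (eps gamma : R).
Variables (D0 : 'M[R]_(n, p)) (L1 L2 : 'M[R]_(q, n)) (D : 'M[R]_(q, m)).
Variables (U : 'M[R]_(m, T)) (X0 X1 : 'M[R]_(n, T)).
Variables (P S R1 R2 S1 S2 : 'M[R]_n) (Q1 Q2 Q3 : 'M[R]_(T, n)).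

Local Notation Gamma :=
  (Gamma_bar h eps gamma D0 L1 L2 D U X0 X1 P S R1 R2 S1 S2 Q1 Q2 Q3).

(* With y listed backwards from time k+1, the first five blocks are the states
   at times k, k-d1, k-d2, k-h and k+1. *)
Definition stacked (y : nat -> 'cV[R]_n) (d1 d2 : nat) (z : 'cV[R]_q)
    (w : 'cV[R]_p) :=
  col_mx (col_mx (col_mx (y 1%N) (col_mx (y d1.+1) (col_mx (y d2.+1)
    (col_mx (y h.+1) (y 0%N))))) z) w.

(** The only losses are the two Jensen inequalities, one for [R1] with delay [d1] and one for [R2]
    with delay [d2]; all else is an identity between values of bilinear forms. *)
Lemma lkf_dissipation (y : nat -> 'cV[R]_n) (d1 d2 : nat)
    (z : 'cV[R]_q) (w : 'cV[R]_p) :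
  R1^T = R1 -> R2^T = R2 ->
  possemidef (symblock_mx R1 S1 R1) -> possemidef (symblock_mx R2 S2 R2) ->
  (d1 <= h)%N -> (d2 <= h)%N ->
  X0 *m Q3 *m y 0%N = X1 *m Q3 *m y 1%N + X1 *m Q2 *m y d1.+1
                      + X1 *m Q1 *m y d2.+1 + D0 *m w ->
  z = L1 *m X0 *m Q3 *m y 1%N + L2 *m X0 *m Q3 *m y d1.+1
      + D *m U *m Q1 *m y d2.+1 ->
  lkf h P S (R1 + R2) y - lkf h P S (R1 + R2) (fun j => y j.+1)
    + (z^T *m z) 0 0 - gamma * (w^T *m w) 0 0
  <= - qform Gamma (stacked y d1 d2 z w).
Proof.
move=> sR1 sR2 psB1 psB2 d1h d2h dyn zE.
have := delayed_jensen (fun j => y j.+1) psB1 d1h.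
have := delayed_jensen (fun j => y j.+1) psB2 d2h.
(* Descriptor method: the dynamics tested against y 1 + eps y 0 supply the terms
   of the matrix inequality that depend on the data. *)
have null u : bform (X0 *m Q3) u (y 0%N) = bform (X1 *m Q3) u (y 1%N)
    + bform (X1 *m Q2) u (y d1.+1) + bform (X1 *m Q1) u (y d2.+1) + bform D0 u w.
  have toid b (A : 'M[R]_(n, b)) v : bform A u v = bform 1%:M u (A *m v).
    by rewrite -bform_mulmx mul1mx.
  by rewrite [LHS]toid dyn !bformDr -!toid.
(* Since [z] is [kappa] applied to the stacked states, the cross term contributes -2|z|^2 and the
   identity block |z|^2, which together give -|z|^2. *)
have kz : bform (kappa L1 L2 D U X0 Q1 Q3) z (col_mx (y 1%N) (col_mx (y d1.+1)
    (col_mx (y d2.+1) (col_mx (y h.+1) (y 0%N))))) = (z^T *m z) 0 0.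
  rewrite /bform -mulmxA /kappa !mul_row_col !mul0mx !addr0 addrA -zE //.
have id1 a (v : 'cV[R]_a) : qform 1%:M v = (v^T *m v) 0 0.
  by rewrite /qform /bform mulmx1.
have qB (M : 'M[R]_n) u v : M^T = M ->
    qform M (u - v) = qform M u - 2 * bform M u v + qform M v.
  by move=> sM; rewrite -scaleN1r qformDZ //; ring.
have symR u v : bform R1 u v = bform R1 v u by exact: bform_sym.
have symR' u v : bform R2 u v = bform R2 v u by exact: bform_sym.
rewrite lkf_shift.
have sumR : \sum_(i < h) qform (R1 + R2) (y i.+1 - y i.+2) =
    \sum_(i < h) qform R1 (y i.+1 - y i.+2) + \sum_(i < h) qform R2 (y i.+1 - y i.+2).
  by rewrite -big_split; apply: eq_bigr => i _; rewrite /qform bformDm.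
have R12s : (R1 + R2)^T = R1 + R2 by rewrite linearD /= sR1 sR2.
rewrite sumR (qB (R1 + R2)) //= !(qB R1) // !(qB R2) //.
rewrite /Gamma_bar /stacked qform_symblock -scalemx1 [qform (_ *: _) _]bformZm.
rewrite -/(qform _ _) id1.
rewrite /kappa2 bform_tr bform_row_mx bform0m /row_mx5 /row_mx4 /row_mx3.
rewrite !bform_row_mx !bform0m.
rewrite /Psi_bar qform_symblock id1 bformNm bform_tr kz.
rewrite /Phi_bar !qform_symblock /row_mx4 /row_mx3 !bform_row_mx !bform0m.
rewrite /Phi11 /Phi12 /Phi13 /Phi14 /Phi15 /Phi22 /Phi24 /Phi25 /Phi33 /Phi34
  /Phi35 /Phi44 /Phi55 -trmx_mul.
rewrite /qform !(bformDl, bformDr, bformNl, bformNr).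
rewrite !(bformDm, bformNm, bformZm, bform_tr, bformDm, bformNm, bformZm).
rewrite !null (symR (y 0%N) (y 1%N)) (symR' (y 0%N) (y 1%N)).
set s1 := \sum_(i < h) _; set s2 := \sum_(i < h) _.
(* With every form value turned into an atom, the goal is a linear combination of the two Jensen
   hypotheses, up to expanding products with [h%:R], [eps] and [gamma]. *)
repeat match goal with |- context [bform ?M ?u ?v] =>
  generalize (bform M u v) => ? end.
by move: (_ 0 0) (_ 0 0) s1 s2 (h%:R) => zz ww s1 s2 hR; lra.
Qed.

(** On vectors supported on the block of the state at time k+1, the form of [Gamma] is that of
    [Phi55]; its negative terms in [P], [R1], [R2] force the form of [X0 *m Q3] to be positive. *)
Lemma X0Q3_unitmx : posdef Gamma -> possemidef P -> possemidef R1 -> possemidef R2 ->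
  0 < eps -> X0 *m Q3 \in unitmx.
Proof.
move=> [_ pG] psP psR1 psR2 eps0; apply: anisotropic_unitmx => u un0.
have : 0 < qform Gamma (stacked (fun j => if j is 0%N then u else 0) 0 0 0 0).
  by apply: pG; rewrite /stacked !col_mx_eq0 (negbTE un0) !(andbF, andFb).
rewrite /Gamma_bar /stacked qform_symblock /Psi_bar /Phi_bar !qform_symblock.
rewrite /qform !(bform0l, bform0r) /Phi55 -trmx_mul.
rewrite !(bformDm, bformNm, bformZm, bform_tr).
have := psd_qform_ge0 u psP; have := psd_qform_ge0 u psR1.
have := psd_qform_ge0 u psR2; rewrite /qform => r2 r1 p0.
have hr : 0 <= h%:R ^+ 2 * (bform R1 u u + bform R2 u u).
  by rewrite mulr_ge0 ?addr_ge0 // exprn_ge0.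
move=> pos; have : 0 < eps * (bform (X0 *m Q3) u u + bform (X0 *m Q3) u u) by lra.
rewrite pmulr_rgt0 // => ?; apply/eqP => b0; lra.
Qed.

End Dissipation.

(** * Energies of sequences and bounds on the gain *)

Section Energy.
Variable R : realType.

Lemma energy_term_ge0 n (v : nat -> 'cV[R]_n) k :
  (0 <= (((v k)^T *m v k) 0 0)%:E)%E.
Proof. by rewrite lee_fin normsq_ge0. Qed.

Lemma energy_le n p (z : nat -> 'cV[R]_n) (w : nat -> 'cV[R]_p) (g : R) :
  0 <= g ->
  (forall N, \sum_(0 <= k < N) ((z k)^T *m z k) 0 0
    <= g * \sum_(0 <= k < N) ((w k)^T *m w k) 0 0) ->
  (energy z <= g%:E * energy w)%E.
Proof.
move=> g0 zw; apply: lime_le.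
  by apply: is_cvg_nneseries => k _ _; exact: energy_term_ge0.
apply: nearW => N /=; rewrite sumEFin.
apply: (@le_trans _ _ (g%:E * (\sum_(0 <= k < N) ((w k)^T *m w k) 0 0)%:E)%E).
  by rewrite -EFinM lee_fin.
rewrite lee_wpmul2l ?lee_fin // -sumEFin.
by apply: nneseries_lim_ge => k _ _; exact: energy_term_ge0.
Qed.

Lemma energy_gt0 n (v : nat -> 'cV[R]_n) k : v k != 0 -> (0 < energy v)%E.
Proof.
move=> vk0; apply: (@lt_le_trans _ _ (\sum_(0 <= i < k.+1) (((v i)^T *m v i) 0 0)%:E)%E).
  rewrite sumEFin lte_fin big_nat_recr //= ltr_wpDl //.
    by apply: sumr_ge0 => i _; exact: normsq_ge0.
  by rewrite (lt_le_trans _ (norm_sq_le _)) // exprn_gt0 // normr_gt0.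
by apply: nneseries_lim_ge => i _ _; exact: energy_term_ge0.
Qed.

Lemma L2_gain_le n p q hbar
    (traj : (nat -> 'cV[R]_p) -> (int -> 'cV[R]_n) -> Prop)
    (out : (int -> 'cV[R]_n) -> nat -> 'cV[R]_q) (g : R) :
  0 <= g ->
  (forall w x N, (forall j : nat, (j <= hbar)%N -> x (- j%:Z) = 0) -> traj w x ->
    \sum_(0 <= k < N) ((out x k)^T *m out x k) 0 0
    <= g * \sum_(0 <= k < N) ((w k)^T *m w k) 0 0) ->
  (L2_gain hbar traj out <= g%:E)%E.
Proof.
move=> g0 gain; apply: ge_ereal_sup => _ [w [x [wfin [k wk0] x0 tr ->]]].
have := energy_le g0 (fun N => gain w x N x0 tr).
have := energy_gt0 wk0; move: wfin.
case: (energy w) => [r| |] // _; rewrite lte_fin => r0.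
rewrite inver gt_eqF // -EFinM.
(* An output energy of +oo contradicts the comparison with the finite energy of [w]; the value -oo
   satisfies any upper bound. *)
case: (energy (out x)) => [s| |] //; last first.
  by move=> _; rewrite gt0_mulNye ?leNye // lte_fin invr_gt0.
by rewrite -EFinM !lee_fin ler_pdivrMr.
Qed.

End Energy.

(** Stability: [E] does not increase and is squeezed between quadratic bounds. Attraction: [E] is
    nonincreasing and nonnegative along a trajectory, hence converges, so its increments tend to 0,
    and they dominate the squared norm of the state. *)
Lemma lyapunov_asymptotically_stable (R : realType) n hbar
    (traj : nat -> (int -> 'cV[R]_n) -> Prop)
    (E : (int -> 'cV[R]_n) -> nat -> R) (a c C : R) :
  0 < a -> 0 < c -> 0 < C ->
  (forall k0, traj k0 (fun=> 0)) ->
  (forall x k, a * `|x k%:Z| ^+ 2 <= E x k) ->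
  (forall x k0 d, history_lt hbar k0 x d -> E x k0 <= C * d ^+ 2) ->
  (forall k0 x k, traj k0 x -> (k0 <= k)%N ->
     E x k.+1 - E x k <= - (c * `|x k%:Z| ^+ 2)) ->
  origin_asymptotically_stable hbar traj.
Proof.
move=> a0 c0 C0 eq0 Elow Eup Edec.
have Edec0 k0 x k : traj k0 x -> (k0 <= k)%N -> E x k.+1 <= E x k.
  move=> tr kk; have := Edec _ _ _ tr kk.
  have : 0 <= c * `|x k%:Z| ^+ 2 by rewrite mulr_ge0 ?sqr_ge0 // ltW.
  lra.
split=> // [k0 e e0|k0].
- have [M0 M1] : 0 < C / a /\ 0 < 1 + C / a.
    by rewrite divr_gt0 // ltr_pwDl // divr_ge0 // ltW.
  (* With M = C / a, the bounds give |x(k)|^2 <= M e^2 / (1 + M)^2, which is below e^2 because M <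
     (1 + M)^2. *)
  exists (e / (1 + C / a)); first by rewrite divr_gt0.
  move=> x tr hist k kk.
  have Ek : E x k <= E x k0.
    elim: k kk => [|k IH]; first by rewrite leqn0 => /eqP ->.
    rewrite leq_eqVlt => /predU1P[->//|kk].
    by rewrite (le_trans (Edec0 _ _ _ tr kk)) // IH.
  have xk : `|x k%:Z| ^+ 2 <= C / a * (e / (1 + C / a)) ^+ 2.
    rewrite mulrAC ler_pdivlMr // mulrC.
    by rewrite (le_trans (Elow _ _)) // (le_trans Ek) // Eup.
  rewrite -(@ltr_pXn2r _ 2) ?nnegrE // ?ltW //.
  apply: (le_lt_trans xk); rewrite expr_div_n mulrCA -[X in _ < X]mulr1.
  rewrite ltr_pM2l ?exprn_gt0 // ltr_pdivrMr ?exprn_gt0 // mul1r.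
  by move: (C / a) M0 => M M0; nra.
(* Attraction is global, so any radius will do. *)
- exists 1 => // x tr _.
  have Ex_ge0 k : 0 <= E x k.
    by apply: le_trans (Elow x k); rewrite mulr_ge0 ?sqr_ge0 // ltW.
  pose u i := E x (i + k0)%N.
  have u_cvg : cvgn u.
    apply: nonincreasing_is_cvgn.
      by apply/nonincreasing_seqP => i; exact: (Edec0 _ _ _ tr (leq_addl _ _)).
    by exists 0 => _ [i _ <-]; exact: Ex_ge0.
  have du : ((u i - u i.+1) @[i --> \oo] --> (0 : R))%classic.
    rewrite -(subrr (limn u)); apply: cvgB => //.
    by rewrite (_ : (fun i => u i.+1) = [sequence u i.+1]_i) // cvg_shiftS.
  rewrite -(cvg_shiftn k0); apply/cvgr0Pnorm_lt => e e0.
  have ce0 : 0 < c * e ^+ 2 by rewrite mulr_gt0 ?exprn_gt0.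
  move/cvgr0Pnorm_lt: du => /(_ _ ce0); apply: filterS => i /= dui.
  rewrite -(@ltr_pXn2r _ 2) ?nnegrE // ?ltW // -(ltr_pM2l c0).
  apply: le_lt_trans dui; apply: le_trans (ler_norm _).
  by have := Edec _ _ _ tr (leq_addl i k0); rewrite /u addSn; lra.
Qed.

(** * The closed loop in the coordinates [v = G^-1 x]: stability, then the gain *)

Theorem corollary4p6 (R : realType) (n m p q T hbar : nat) (gamma eps : R)
  (A0 A1 : 'M[R]_n) (B : 'M[R]_(n, m)) (D0 : 'M[R]_(n, p))
  (L1 L2 : 'M[R]_(q, n)) (D : 'M[R]_(q, m))
  (d1 d2 : nat) (ud : int -> 'cV[R]_m) (xd : int -> 'cV[R]_n)
  (U : 'M[R]_(m, T)) (Xh X0 X1 : 'M[R]_(n, T))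
  (P S R1 R2 S1 S2 : 'M[R]_n) (Q1 Q2 Q3 : 'M[R]_(T, n)) (K : 'M[R]_(m, n)) :
  (0 < hbar)%N -> 0 < gamma -> 0 < eps ->
  (* recorded data, with constant delays d1 and d2 *)
  (hbar < T)%N -> (d1 <= hbar)%N -> (d2 <= hbar)%N ->
  (forall k : nat, (k < T)%N ->
     xd (k%:Z + 1) = A0 *m xd k%:Z + A1 *m xd (k%:Z - d1%:Z)
                     + B *m ud (k%:Z - d2%:Z)) ->
  U = data_mx T ud (- d2%:Z) -> Xh = data_mx T xd (- d1%:Z) ->
  X0 = data_mx T xd 0 -> X1 = data_mx T xd 1 ->
  \rank (col_mx U (col_mx Xh X0)) = (m + 2 * n)%N ->
  (* matrix inequalities and equations *)
  posdef P -> posdef S -> posdef R1 -> posdef R2 -> posdef S1 -> posdef S2 ->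
  posdef (Gamma_bar hbar eps gamma D0 L1 L2 D U X0 X1
            P S R1 R2 S1 S2 Q1 Q2 Q3) ->
  possemidef (symblock_mx R1 S1 R1) -> possemidef (symblock_mx R2 S2 R2) ->
  U *m Q2 = 0 -> U *m Q3 = 0 ->
  Xh *m Q1 = 0 -> Xh *m Q3 = 0 ->
  X0 *m Q1 = 0 -> X0 *m Q2 = 0 ->
  Xh *m Q2 = X0 *m Q3 ->
  K = U *m Q1 *m invmx (X0 *m Q3) ->
  forall h1 h2 : nat -> nat,
  (forall k, (h1 k <= hbar)%N) -> (forall k, (h2 k <= hbar)%N) ->
  origin_asymptotically_stable hbar
    (closed_loop A0 A1 B K D0 h1 h2 (fun=> 0)) /\
  (L2_gain hbar (fun w => closed_loop A0 A1 B K D0 h1 h2 w 0)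
     (output K L1 L2 D h1 h2) < gamma%:E)%E.
Proof.
move=> h0 gamma0 eps0 hT _ _ data UE XhE X0E X1E _ pP pS pR1 pR2 _ _ pGamma psB1 psB2.
move=> UQ2 UQ3 XhQ1 XhQ3 X0Q1 X0Q2 XhQ2 KE h1 h2 h1le h2le.
(* Column j is the recorded dynamics at time j. After multiplication by one of the Q matrices, the
   equality constraints leave a single term on the right. *)
have X1eq : X1 = A0 *m X0 + A1 *m Xh + B *m U.
  have colE b (A : 'M[R]_(n, b)) (v : int -> 'cV[R]_b) s i j :
      (A *m data_mx T v s) i j = (A *m v (s + j%:Z)) i 0.
    by rewrite !mxE; apply: eq_bigr => l _; rewrite mxE.
  apply/matrixP => i j; rewrite X1E mxE addrC data // UE XhE X0E.
  rewrite [LHS]mxE [X in X + _ = _]mxE [RHS]mxE [X in _ = X + _]mxE !colE add0r.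
  by rewrite ![_ - _%:Z]addrC.
have uG : X0 *m Q3 \in unitmx.
  by apply: (X0Q3_unitmx pGamma) => //; exact: posdef_psd.
have X1Q3 : X1 *m Q3 = A0 *m (X0 *m Q3).
  by rewrite X1eq !mulmxDl -!mulmxA XhQ3 UQ3 !mulmx0 !addr0.
have X1Q2 : X1 *m Q2 = A1 *m (X0 *m Q3).
  by rewrite X1eq !mulmxDl -!mulmxA X0Q2 UQ2 XhQ2 !mulmx0 add0r addr0.
have UQ1 : U *m Q1 = K *m (X0 *m Q3) by rewrite KE mulmxKV.
have X1Q1 : X1 *m Q1 = B *m K *m (X0 *m Q3).
  by rewrite X1eq !mulmxDl -!mulmxA X0Q1 XhQ1 UQ1 !mulmx0 !add0r.
set G := X0 *m Q3 in uG X1Q3 X1Q2 UQ1 X1Q1.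
pose v (x : int -> 'cV[R]_n) t := invmx G *m x t.
have Gv x t : G *m v x t = x t by rewrite /v mulKVmx.
pose E x k := lkf hbar P S (R1 + R2) (fun j => v x (k%:Z - j%:Z)).
have [c c0 cGamma] := posdef_coercive pGamma.
have dissip w k0 x k : closed_loop A0 A1 B K D0 h1 h2 w k0 x -> (k0 <= k)%N ->
    E x k.+1 - E x k
    + ((output K L1 L2 D h1 h2 x k)^T *m output K L1 L2 D h1 h2 x k) 0 0
    - gamma * ((w k)^T *m w k) 0 0
    <= - (c * (((v x k%:Z)^T *m v x k%:Z) 0 0 + ((w k)^T *m w k) 0 0)).
  move=> /(_ k) dyn /dyn {}dyn.
  pose y j := v x (k.+1%:Z - j%:Z).
  have yS j : y j.+1 = v x (k%:Z - j%:Z).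
    by rewrite /y !intS; congr (v x _); ring.
  have y0 : y 0%N = v x (k%:Z + 1) by rewrite /y intS; congr (v x _); ring.
  have y1 : y 1%N = v x k%:Z by rewrite yS subr0.
  have -> : E x k = lkf hbar P S (R1 + R2) (fun j => y j.+1).
    by rewrite /E; congr lkf; apply/funext => j; rewrite yS.
  have dynG : G *m y 0%N = X1 *m Q3 *m y 1%N + X1 *m Q2 *m y (h1 k).+1
      + X1 *m Q1 *m y (h2 k).+1 + D0 *m w k.
    by rewrite X1Q3 X1Q2 X1Q1 y0 y1 !yS -!(mulmxA _ G) !Gv dyn.
  have outG : output K L1 L2 D h1 h2 x k = L1 *m X0 *m Q3 *m y 1%N
      + L2 *m X0 *m Q3 *m y (h1 k).+1 + D *m U *m Q1 *m y (h2 k).+1.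
    rewrite -!(mulmxA _ X0 Q3) -(mulmxA D) UQ1 -/G y1 !yS (mulmxA D).
    by rewrite -!(mulmxA _ G) !Gv.
  have := lkf_dissipation eps gamma P S (proj1 pR1) (proj1 pR2) psB1 psB2
    (h1le k) (h2le k) dynG outG.
  move=> /le_trans; apply.
  (* Of the squared norm of the stacked vector, only the blocks v(k) and w(k) are kept. *)
  rewrite lerN2 (le_trans _ (cGamma _)) // ler_wpM2l ?(ltW c0) //.
  rewrite /stacked !normsq_col_mx y1.
  have := normsq_ge0 (y (h1 k).+1); have := normsq_ge0 (y (h2 k).+1).
  have := normsq_ge0 (y hbar.+1); have := normsq_ge0 (y 0%N).
  have := normsq_ge0 (output K L1 L2 D h1 h2 x k).
  lra.
have psS := posdef_psd pS; have psP := posdef_psd pP.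
have psR : possemidef (R1 + R2).
  split=> [|u]; first by rewrite linearD /= (proj1 pR1) (proj1 pR2).
  rewrite -/(bform (R1 + R2) u u) bformDm.
  by rewrite addr_ge0 // psd_qform_ge0 //; exact: posdef_psd.
have E_ge k x : qform P (v x k%:Z) <= E x k.
  have := @lkf_ge _ n hbar P S (R1 + R2) (fun j => v x (k%:Z - j%:Z)) psS psR.
  by rewrite subr0.
split.
- have [CG CG0 GC] := mulmx_norm_le G.
  have [CI CI0 IC] := mulmx_norm_le (invmx G).
  have [CE CE0 EC] := lkf_norm_le hbar P S (R1 + R2).
  have [cP cP0 Pc] := posdef_coercive pP.
  have vx x k : `|x k| ^+ 2 <= CG ^+ 2 * ((v x k)^T *m v x k) 0 0.
    rewrite -[in X in X <= _](Gv x k) (@le_trans _ _ (CG ^+ 2 * `|v x k| ^+ 2)) //.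
      rewrite -exprMn ler_pXn2r ?nnegrE ?GC //.
      by rewrite mulr_ge0 // ltW.
    by rewrite ler_wpM2l ?exprn_ge0 ?(ltW CG0) // norm_sq_le.
  (* Passing from [v] to x = G v costs [CG ^+ 2] in the lower bound and in the decrease; passing
     from x to [v] costs [CI ^+ 2] in the upper bound. *)
  apply: (@lyapunov_asymptotically_stable _ _ _ _ E (cP / CG ^+ 2) (c / CG ^+ 2)
    (CE * CI ^+ 2)).
  + by rewrite divr_gt0 // exprn_gt0.
  + by rewrite divr_gt0 // exprn_gt0.
  + by rewrite mulr_gt0 // exprn_gt0.
  + by move=> k0 k _; rewrite !mulmx0 !addr0.
  + move=> x k; apply: le_trans (E_ge k x); apply: le_trans (Pc _).
    by rewrite -mulrA ler_wpM2l ?(ltW cP0) // ler_pdivrMl ?exprn_gt0.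
  + move=> x k0 d hist; rewrite -mulrA -exprMn; apply: EC => j jh.
    rewrite (le_trans (IC _)) // ler_wpM2l ?(ltW CI0) // ltW //.
    exact: hist.
  + move=> k0 x k tr kk; have := dissip _ _ _ _ tr kk.
    have := normsq_ge0 (output K L1 L2 D h1 h2 x k).
    have : c / CG ^+ 2 * `|x k%:Z| ^+ 2 <= c * ((v x k%:Z)^T *m v x k%:Z) 0 0.
      by rewrite -mulrA ler_wpM2l ?(ltW c0) // ler_pdivrMl ?exprn_gt0.
    rewrite mulmx0 !mxE; lra.
(* The margin is capped at [gamma / 2] so that [g] stays nonnegative while still being at least
   [gamma - c]. *)
- pose g := gamma - Num.min c (gamma / 2).
  have [gc g0 ggamma] : [/\ gamma - c <= g, 0 <= g & g < gamma].
    rewrite /g; by case: (leP c (gamma / 2)) => ?; split; lra.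
  apply: (@le_lt_trans _ _ g%:E); last by rewrite lte_fin.
  apply: L2_gain_le => // w x N x0 tr.
  (* At time 0 the functional reads exactly the states from -hbar to 0, all zero by the initial
     condition. *)
  have E0 : E x 0%N = 0.
    have v0 j : (j <= hbar)%N -> v x (- j%:Z) = 0.
      by move=> jh; rewrite /v x0 // mulmx0.
    rewrite /E /lkf sub0r v0 // /qform bform0l add0r big1 => [|j _].
      rewrite add0r big1 ?mulr0 // => i _; rewrite big1 // => j _.
      have jh : (j < hbar)%N by rewrite (leq_trans (ltn_ord j)).
      by rewrite !sub0r !v0 ?subrr ?bform0l // ltnW.
    by rewrite sub0r v0 ?bform0l.
  (* Keeping the stored term [E x N] lets the dissipation inequality telescope by induction; it is
     then dropped as nonnegative. *)
  suff : E x N + \sum_(0 <= k < N)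
      ((output K L1 L2 D h1 h2 x k)^T *m output K L1 L2 D h1 h2 x k) 0 0
      <= g * \sum_(0 <= k < N) ((w k)^T *m w k) 0 0.
    have := psd_qform_ge0 (v x N%:Z) psP; have := E_ge N x; lra.
  elim: N => [|N IH]; first by rewrite !big_geq // E0 mulr0 addr0.
  rewrite !big_nat_recr //= mulrDr.
  have := dissip _ _ _ N tr (leq0n N).
  have : 0 <= c * ((v x N%:Z)^T *m v x N%:Z) 0 0.
    by rewrite mulr_ge0 ?normsq_ge0 ?(ltW c0).
  have : (gamma - c) * ((w N)^T *m w N) 0 0 <= g * ((w N)^T *m w N) 0 0.
    by rewrite ler_wpM2r // normsq_ge0.
  lra.
Qed.
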